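(* Let $n=2$ and let $\Gamma\neq 0$ be a real trilinear (completely symmetric) $2\times2\times2$ tensor, with $a_3=\Gamma^1_{11}$, $a_2=\Gamma^2_{11}=\Gamma^1_{12}$, $a_1=\Gamma^1_{22}=\Gamma^2_{12}$, $a_0=\Gamma^2_{22}$. Then $\Gamma$ is fully decoupleable if and only if $$a_2(a_2-a_0)=a_1(a_3-a_1).$$ Moreover, when this relation holds, the tensors $R=\sigma_\theta\circ\Gamma$ and $S=(\sigma_\psi\mathcal{N})\circ\Gamma$ are in fully decoupled reduced form whenever the angles $\theta,\psi\in[0,2\pi)$ satisfy $$e^{4i\theta}=\frac{(a_0+a_2)+i(a_1+a_3)}{(a_0-3a_2)+i(a_3-3a_1)},\qquad e^{4i\psi}=\frac{(a_3+a_1)+i(a_2+a_0)}{(a_3-3a_1)+i(a_0-3a_2)},$$ and then $$R^2_{22}+iR^1_{11}=e^{-i\theta}\big[(a_0+a_2)+i(a_1+a_3)\big],\qquad S^2_{22}+iS^1_{11}=e^{-i\psi}\big[(a_3+a_1)+i(a_0+a_2)\big].$$ The maps $\sigma_\theta$ for the four such $\theta$ and $\sigma_\psi\mathcal{N}$ for the four such $\psi$ are the only elements $\sigma\in O(2)$ for which $\sigma\circ\Gamma$ is in fully decoupled reduced form.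
   Context: A real $2\times2\times2$ tensor $\Gamma=(\Gamma^i_{jk})$ is trilinear if $\Gamma^i_{jk}=\Gamma^i_{kj}=\Gamma^j_{ik}$ for all $i,j,k$. The group $O(2)$ acts by $(\sigma\circ\Gamma)^i_{jk}=\sum_{i',j',k'}\sigma_{ii'}\sigma_{jj'}\sigma_{kk'}\Gamma^{i'}_{j'k'}$. A tensor $R$ is in fully decoupled reduced form if for each $i$, $R^i_{jk}=0$ for all $(j,k)\ne(i,i)$. $\Gamma$ is fully decoupleable if $\sigma\circ\Gamma$ is in fully decoupled reduced form for some $\sigma\in O(2)$. Notation: $$\sigma_\theta=\begin{pmatrix}\cos\theta&-\sin\theta\\ \sin\theta&\cos\theta\end{pmatrix},\qquad \mathcal{N}=\begin{pmatrix}0&1\\1&0\end{pmatrix}$$ (so $\mathcal{N}(x_1,x_2)=(x_2,x_1)$). In exponents and complex expressions $i=\sqrt{-1}$. *)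

(* Defs.v *)
From mathcomp Require Export all_boot all_order all_algebra.
From mathcomp Require Export all_classical all_reals all_analysis.
From mathcomp Require Export complex.

Set Implicit Arguments.
Unset Strict Implicit.
Unset Printing Implicit Defensive.

Import Order.TTheory GRing.Theory Num.Theory.
Local Open Scope ring_scope.

(* [G i j k] is the coefficient with upper index i and lower indices j, k. *)
Notation tensor R n := {ffun 'I_n -> 'M[R]_n}.

Section Tensors.
Variables (R : realType) (n : nat).

Definition trilinear (G : tensor R n) : Prop :=
  forall i j k, G i j k = G i k j /\ G i j k = G j i k.

Definition tensor_act (s : 'M[R]_n) (G : tensor R n) : tensor R n :=
  [ffun i => \matrix_(j, k)
    \sum_(i' < n) \sum_(j' < n) \sum_(k' < n)
      s i i' * s j j' * s k k' * G i' j' k'].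

Definition orthogonal_mx (s : 'M[R]_n) : Prop := s *m s^T = 1%:M.

Definition fully_decoupled (G : tensor R n) : Prop :=
  forall i j k, (j, k) <> (i, i) -> G i j k = 0.

Definition fully_decoupleable (G : tensor R n) : Prop :=
  exists s : 'M[R]_n, orthogonal_mx s /\ fully_decoupled (tensor_act s G).

End Tensors.

Section Dimension2.
Variable R : realType.

Definition mx2 (a b c d : R) : 'M[R]_2 :=
  \matrix_(i, j) if i == ord0 then (if j == ord0 then a else b)
                 else (if j == ord0 then c else d).

Definition rotation (t : R) : 'M[R]_2 := mx2 (cos t) (- sin t) (sin t) (cos t).

Definition swap_mx : 'M[R]_2 := mx2 0 1 1 0.

(* e^{it} *)
Definition expi (t : R) : R[i] := (cos t +i* sin t)%C.

End Dimension2.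

Arguments swap_mx {R}.

(* The indices 1 and 2 of the two-dimensional setting. *)
Notation ix1 := (ord0 : 'I_2).
Notation ix2 := (ord_max : 'I_2).

(* Main.v *)
(** Split the cubic form of [G] into its trace part [u] and its harmonic part
    [w], read as complex numbers with index 2 on the real axis and index 1 on
    the imaginary one: rotating by [t] multiplies [u] by [e^{-it}] and [w] by
    [e^{3it}], and [G] is fully decoupled iff [u = w].  Hence [rotation t]
    decouples [G] iff [e^{4it} w = u], which is solvable iff [|u| = |w|]; up to
    a factor, [|u|^2 - |w|^2] is the relation between the coefficients.  Every
    orthogonal matrix is a rotation, possibly preceded by [swap_mx], and
    [swap_mx] preserves both [|u|] and [|w|]. *)
Require Import Defs.
From mathcomp Require Import ring lra.

Set Implicit Arguments.
Unset Strict Implicit.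
Unset Printing Implicit Defensive.

Import Order.TTheory GRing.Theory Num.Theory.
Local Open Scope classical_set_scope.
Local Open Scope ring_scope.

Lemma complex_ext (T : Type) (z w : T[i]) :
  complex.Re z = complex.Re w -> complex.Im z = complex.Im w -> z = w.
Proof. by case: z w => [a b] [c d] /= -> ->. Qed.

Section Expi.
Variable R : realType.
Implicit Types (s t : R) (z w : R[i]) (n : nat).

Lemma expi0 : expi (0 : R) = 1.
Proof. by rewrite /expi cos0 sin0. Qed.

Lemma expiD s t : expi (s + t) = expi s * expi t.
Proof. by apply: complex_ext; rewrite /= ?cosD ?sinD; ring. Qed.

Lemma normr_expi t : `|expi t| = 1.
Proof. by rewrite normc_def /= cos2Dsin2 sqrtr1. Qed.

Lemma expi_neq0 t : expi t != 0.
Proof. by rewrite -normr_eq0 normr_expi oner_eq0. Qed.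

Lemma expiN t : expi (- t) = (expi t)^-1.
Proof.
apply: (mulIf (expi_neq0 t)).
by rewrite -expiD addNr expi0 mulVf ?expi_neq0.
Qed.

Lemma expiM_natl n t : expi (n%:R * t) = expi t ^+ n.
Proof.
elim: n => [|n IHn]; first by rewrite mul0r expi0.
by rewrite -natr1 mulrDl mul1r expiD IHn exprSr.
Qed.

Lemma expi_periodic : periodic (@expi R) (pi *+ 2).
Proof. by move=> t; rewrite /expi cosD2pi sinD2pi. Qed.

Lemma expi_surj z : `|z| = 1 -> exists2 t, 0 <= t < pi *+ 2 & expi t = z.
Proof.
case: z => a b; rewrite normc_def /= => -[/(congr1 (fun x => x ^+ 2))].
rewrite sqr_sqrtr ?addr_ge0 ?sqr_ge0// expr1n => unit_ab.
have a_itv : -1 <= a <= 1 by apply/andP; split; nra.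
have cosE : cos (acos a) = a by rewrite acosK ?in_itv.
have sinE : sin (acos a) = `|b|.
  by rewrite sin_acos// -sqrtr_sqr; congr Num.sqrt; lra.
have := acos_ge0 a_itv; have := acos_lepi a_itv => acos_le acos_ge.
have pi_pos := pi_gt0 R.
have [b0|b0] := leP 0 b.
  exists (acos a); first by apply/andP; split; lra.
  by rewrite /expi cosE sinE ger0_norm.
exists (- acos a + pi *+ 2).
  have acos_pos : 0 < acos a by apply: acos_gt0; apply/andP; split; nra.
  by apply/andP; split; lra.
by rewrite expi_periodic /expi cosN sinN cosE sinE ltr0_norm// opprK.
Qed.

Lemma expi_eq1 t : 0 <= t < pi *+ 2 -> expi t = 1 -> t = 0.
Proof.
move=> /andP[t0 t2pi] [cos1 _].
have sin_half0 : sin (t / 2) = 0.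
  have := cos_mulr2n (t / 2).
  rewrite -[t / 2 *+ 2]mulr_natr divfK// cos1 cos2sin2.
  by move=> cos_half; apply/eqP; rewrite -sqrf_eq0; apply/eqP; lra.
apply/eqP/contraT => t_neq0.
have t_gt0 : 0 < t by rewrite lt_neqAle eq_sym t_neq0.
have : 0 < sin (t / 2) by apply: sin_gt0_pi; apply/andP; split; lra.
by rewrite sin_half0 ltxx.
Qed.

Lemma expi_inj : {in `[0, pi *+ 2[ &, injective (@expi R)}.
Proof.
move=> s t; wlog st : s t / s <= t => [inj_le s_itv t_itv e|].
  have [/inj_le|/ltW/inj_le inj_ts] := leP s t; first exact.
  exact/esym/inj_ts.
rewrite !in_itv /= => /andP[s0 s2] /andP[t0 t2] e.
apply/eqP; rewrite eq_sym -subr_eq0; apply/eqP/expi_eq1.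
  by apply/andP; split; lra.
by rewrite expiD expiN e divff ?expi_neq0.
Qed.

Lemma expi_eq_mod2pi s t : 0 <= s < pi *+ 2 -> 0 <= t -> expi s = expi t ->
  exists k, t = s + pi *+ 2 *+ k.
Proof.
move=> s2pi t0 e; have pi_pos := pi_gt0 R.
have pi2_pos : 0 < pi *+ 2 :> R by rewrite pmulrn_lgt0.
pose k := Num.truncn (t / (pi *+ 2)).
have /andP[] := truncn_itv (divr_ge0 t0 (ltW pi2_pos)); rewrite -/k.
rewrite ler_pdivlMr// ltr_pdivrMr// !mulr_natl => kt tk.
exists k; suff <- : t - pi *+ 2 *+ k = s by rewrite subrK.
apply: expi_inj; rewrite ?in_itv//=.
  by rewrite subr_ge0 kt ltrBlDr -mulrS.
by rewrite -(periodicn expi_periodic k) subrK e.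
Qed.

Lemma expiM_natl_preimage n s : (0 < n)%N -> 0 <= s < pi *+ 2 ->
  [set t | 0 <= t < pi *+ 2 /\ expi (n%:R * t) = expi s] =
  [set (s + pi *+ 2 *+ k) / n%:R | k in `I_n].
Proof.
move=> n_gt0 s2pi; have /andP[s0 s2] := s2pi; have pi_pos := pi_gt0 R.
have nR_pos : 0 < n%:R :> R by rewrite ltr0n.
apply/seteqP; split=> [t [/andP[t0 t2] e]|_ [k /= kn <-]].
  have [k tE] := expi_eq_mod2pi s2pi (mulr_ge0 (ltW nR_pos) t0) (esym e).
  exists k; last by rewrite -tE mulrC mulKf// gt_eqF.
  have : pi *+ 2 *+ k < pi *+ 2 *+ n :> R by rewrite -[ltRHS]mulr_natl; nra.
  by rewrite ltr_pMn2l// pmulrn_lgt0.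
have pi2_pos : 0 < pi *+ 2 :> R by rewrite pmulrn_lgt0.
split; last by rewrite mulrC divfK ?gt_eqF// (periodicn expi_periodic).
have k_ge0 : 0 <= pi *+ 2 *+ k :> R by rewrite mulrn_wge0 ?ltW.
have : pi *+ 2 *+ k.+1 <= pi *+ 2 *+ n :> R by rewrite ler_pMn2l.
rewrite mulrS => k_lt; apply/andP; split; first by apply: divr_ge0; lra.
by rewrite ltr_pdivrMr// mulr_natr; lra.
Qed.

Lemma card_expiM_natl n z : (0 < n)%N -> `|z| = 1 ->
  ([set t | (0 <= t < pi *+ 2)%R /\ expi (n%:R * t) = z] #= `I_n)%card.
Proof.
move=> n_gt0 /expi_surj[s s2pi <-]; rewrite expiM_natl_preimage//.
have pi2_pos : 0 < pi *+ 2 :> R by rewrite pmulrn_lgt0 ?pi_gt0.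
apply: inj_card_eq => j k _ _ /(divIf _); rewrite pnatr_eq0 -lt0n => /(_ n_gt0).
by move=> /addrI/mulrIn; apply; rewrite gt_eqF.
Qed.

Lemma exists_expi_mulP z w : (exists t, expi t * w = z) <-> `|z| = `|w|.
Proof.
split=> [[t <-]|e]; first by rewrite normrM normr_expi mul1r.
have [w0|w0] := eqVneq w 0.
  by exists 0; apply/eqP; rewrite w0 mulr0 eq_sym -normr_eq0 e w0 normr0.
have /expi_surj[t _ et] : `|z / w| = 1 by rewrite normf_div e divff ?normr_eq0.
by exists t; rewrite et divfK.
Qed.

End Expi.

Section TensorAction.
Variables (R : realType) (n : nat).
Implicit Types (G : tensor R n) (s : 'M[R]_n).

Lemma tensor_actE s G i j k : tensor_act s G i j k =
  \sum_i' \sum_j' \sum_k' s i i' * s j j' * s k k' * G i' j' k'.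
Proof. by rewrite ffunE mxE. Qed.

Lemma tensor_act_tripleE s G i j k : tensor_act s G i j k =
  \sum_(p : 'I_n * 'I_n * 'I_n)
    s i p.1.1 * s j p.1.2 * s k p.2 * G p.1.1 p.1.2 p.2.
Proof. by rewrite tensor_actE !pair_bigA. Qed.

Lemma mulmx_tripleE s1 s2 i j k i' j' k' :
  (s1 *m s2) i i' * (s1 *m s2) j j' * (s1 *m s2) k k' =
  \sum_(p : 'I_n * 'I_n * 'I_n) (s1 i p.1.1 * s1 j p.1.2 * s1 k p.2) *
    (s2 p.1.1 i' * s2 p.1.2 j' * s2 p.2 k').
Proof.
rewrite !mxE big_distrlr pair_bigA big_distrlr pair_bigA.
by apply: eq_bigr => p _ /=; ring.
Qed.

Lemma tensor_actM s1 s2 G :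
  tensor_act (s1 *m s2) G = tensor_act s1 (tensor_act s2 G).
Proof.
apply/ffunP => i; apply/matrixP => j k; rewrite !tensor_act_tripleE.
under eq_bigr do rewrite mulmx_tripleE mulr_suml.
under [RHS]eq_bigr do rewrite tensor_act_tripleE mulr_sumr.
rewrite exchange_big; apply: eq_bigr => p _; apply: eq_bigr => q _.
by rewrite -!mulrA.
Qed.

Lemma trilinear_tensor_act s G : trilinear G -> trilinear (tensor_act s G).
Proof.
move=> G_tri i j k; rewrite !tensor_actE; split.
  apply: eq_bigr => i' _; rewrite exchange_big /=.
  apply: eq_bigr => k' _; apply: eq_bigr => j' _.
  by rewrite (G_tri i' j' k').1 [_ * s j j' * _]mulrAC.
rewrite exchange_big /=; apply: eq_bigr => j' _; apply: eq_bigr => i' _.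
by apply: eq_bigr => k' _; rewrite (G_tri i' j' k').2 [s i i' * _]mulrC.
Qed.

Lemma orthogonal_mxM s1 s2 :
  orthogonal_mx s1 -> orthogonal_mx s2 -> orthogonal_mx (s1 *m s2).
Proof.
rewrite /orthogonal_mx => s1_orth s2_orth.
by rewrite trmx_mul mulmxA -(mulmxA s1) s2_orth mulmx1.
Qed.

Lemma sqr_det_orthogonal s : orthogonal_mx s -> (\det s) ^+ 2 = 1.
Proof. by move=> s_orth; rewrite expr2 -{2}det_tr -det_mulmx s_orth det1. Qed.

End TensorAction.

Lemma ord2_ind (P : 'I_2 -> Prop) : P ix1 -> P ix2 -> forall i, P i.
Proof.
move=> P1 P2 [[|[|//]] lti].
  by rewrite (_ : Ordinal _ = ix1)//; exact: val_inj.
by rewrite (_ : Ordinal _ = ix2)//; exact: val_inj.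
Qed.

Lemma big_ord2 (T : Type) (idx : T) (op : Monoid.law idx) (F : 'I_2 -> T) :
  \big[op/idx]_(i < 2) F i = op (F ix1) (F ix2).
Proof.
by rewrite big_ord_recl big_ord1; congr (op _ (F _)); exact: val_inj.
Qed.

Lemma det_mx2 (T : comNzRingType) (s : 'M[T]_2) :
  \det s = s ix1 ix1 * s ix2 ix2 - s ix1 ix2 * s ix2 ix1.
Proof.
rewrite (expand_det_row s ix1) big_ord2 /cofactor !det_mx11 !mxE /=.
rewrite expr0 expr1 mul1r mulN1r mulrN.
by congr (_ * s _ _ - _ * s _ _); exact: val_inj.
Qed.

Section PlaneIsometries.
Variable R : realType.
Implicit Types (s : 'M[R]_2) (t : R).

Lemma orthogonal_rotation t : orthogonal_mx (rotation t).
Proof.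
have cos_sin := cos2Dsin2 t; apply/matrixP.
by do 2![apply: ord2_ind]; rewrite !mxE big_ord2 !mxE /=; lra.
Qed.

Lemma swap_mxK : swap_mx *m swap_mx = 1%:M :> 'M[R]_2.
Proof.
apply/matrixP.
by do 2![apply: ord2_ind]; rewrite !mxE big_ord2 !mxE /=; ring.
Qed.

Lemma orthogonal_swap : orthogonal_mx (@swap_mx R).
Proof.
suff swapT : swap_mx^T = swap_mx :> 'M[R]_2.
  by rewrite /orthogonal_mx swapT swap_mxK.
by apply/matrixP; do 2![apply: ord2_ind]; rewrite !mxE.
Qed.

Lemma det_swap : \det (@swap_mx R) = -1.
Proof. by rewrite det_mx2 !mxE /=; ring. Qed.

Lemma orthogonal_det1_rotation s : orthogonal_mx s -> \det s = 1 ->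
  exists2 t, 0 <= t < pi *+ 2 & s = rotation t.
Proof.
rewrite /orthogonal_mx => /matrixP s_orth; rewrite det_mx2.
have := s_orth ix1 ix1; have := s_orth ix2 ix2.
rewrite !mxE !big_ord2 !mxE /=.
set a := s ix1 ix1; set b := s ix1 ix2; set c := s ix2 ix1; set d := s ix2 ix2.
move=> row2 row1 det1.
(* The sum of the squared row norms minus twice the determinant. *)
have /eqP : (d - a) ^+ 2 + (c + b) ^+ 2 = 0 by lra.
rewrite paddr_eq0 ?sqr_ge0// !sqrf_eq0 subr_eq0 addr_eq0.
move=> /andP[/eqP da /eqP cb].
have /expi_surj[t t2pi [ta tc]] : `|(a +i* c)%C| = 1.
  by rewrite normc_def /= cb sqrrN !expr2 row1 sqrtr1.
exists t => //; apply/matrixP.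
by do 2![apply: ord2_ind]; rewrite mxE /= ?ta ?tc // cb opprK.
Qed.

Lemma orthogonal_mx2P s : orthogonal_mx s ->
  exists2 t, 0 <= t < pi *+ 2 & s = rotation t \/ s = rotation t *m swap_mx.
Proof.
move=> s_orth; have /eqP := sqr_det_orthogonal s_orth.
rewrite sqrf_eq1 => /orP[] /eqP det_s.
  have [t t2pi ->] := orthogonal_det1_rotation s_orth det_s.
  by exists t; last left.
have swap_orth := orthogonal_mxM s_orth orthogonal_swap.
have [|t t2pi st] := orthogonal_det1_rotation swap_orth.
  by rewrite det_mulmx det_s det_swap mulrNN mulr1.
by exists t; last by right; rewrite -st -mulmxA swap_mxK mulmx1.
Qed.

End PlaneIsometries.

Section PlaneTensors.
Variable R : realType.
Implicit Types (G : tensor R 2) (s : 'M[R]_2) (t : R).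

Lemma trilinear2E G : trilinear G ->
  (G ix1 ix1 ix2 = G ix2 ix1 ix1) * (G ix1 ix2 ix1 = G ix2 ix1 ix1) *
  (G ix2 ix1 ix2 = G ix1 ix2 ix2) * (G ix2 ix2 ix1 = G ix1 ix2 ix2).
Proof.
move=> G_tri; do !split.
- by rewrite (G_tri _ _ _).1 (G_tri _ _ _).2.
- by rewrite (G_tri _ _ _).2.
- by rewrite (G_tri _ _ _).2.
- by rewrite (G_tri _ _ _).1 (G_tri _ _ _).2.
Qed.

Definition trace_part G : R[i] :=
  ((G ix2 ix2 ix2 + G ix2 ix1 ix1) +i* (G ix1 ix2 ix2 + G ix1 ix1 ix1))%C.

Definition harmonic_part G : R[i] :=
  ((G ix2 ix2 ix2 - 3 * G ix2 ix1 ix1)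
   +i* (G ix1 ix1 ix1 - 3 * G ix1 ix2 ix2))%C.

Lemma trace_part_rotation t G : trilinear G ->
  trace_part (tensor_act (rotation t) G) = expi (- t) * trace_part G.
Proof.
move=> /trilinear2E GE.
rewrite /trace_part !tensor_actE !big_ord2 !mxE /= !GE.
by apply: complex_ext; rewrite /= cosN sinN -[RHS]mul1r -(cos2Dsin2 t); ring.
Qed.

Lemma harmonic_part_rotation t G : trilinear G ->
  harmonic_part (tensor_act (rotation t) G) = expi t ^+ 3 * harmonic_part G.
Proof.
move=> /trilinear2E GE.
rewrite /harmonic_part !tensor_actE !big_ord2 !mxE /= !GE.
by rewrite !exprS expr0 mulr1; apply: complex_ext; rewrite /=; ring.
Qed.

Lemma trace_part_swap G : trace_part (tensor_act swap_mx G) =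
  ((G ix1 ix1 ix1 + G ix1 ix2 ix2) +i* (G ix2 ix1 ix1 + G ix2 ix2 ix2))%C.
Proof.
rewrite /trace_part !tensor_actE !big_ord2 !mxE /=.
by apply: complex_ext; rewrite /=; ring.
Qed.

Lemma harmonic_part_swap G : harmonic_part (tensor_act swap_mx G) =
  ((G ix1 ix1 ix1 - 3 * G ix1 ix2 ix2)
   +i* (G ix2 ix2 ix2 - 3 * G ix2 ix1 ix1))%C.
Proof.
rewrite /harmonic_part !tensor_actE !big_ord2 !mxE /=.
by apply: complex_ext; rewrite /=; ring.
Qed.

Lemma normr_trace_part_swap G :
  `|trace_part (tensor_act swap_mx G)| = `|trace_part G|.
Proof.
rewrite trace_part_swap !normc_def; congr (Num.sqrt _)%:C%C.
by rewrite /=; ring.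
Qed.

Lemma normr_harmonic_part_swap G :
  `|harmonic_part (tensor_act swap_mx G)| = `|harmonic_part G|.
Proof.
rewrite harmonic_part_swap !normc_def; congr (Num.sqrt _)%:C%C.
exact: addrC.
Qed.

Lemma harmonic_part_swap_eq0 G :
  (harmonic_part (tensor_act swap_mx G) == 0) = (harmonic_part G == 0).
Proof. by rewrite -normr_eq0 normr_harmonic_part_swap normr_eq0. Qed.

Lemma fully_decoupledP G : trilinear G ->
  fully_decoupled G <-> trace_part G = harmonic_part G.
Proof.
move=> /trilinear2E GE; split=> [G_dec|[re im]].
  rewrite /trace_part /harmonic_part.
  rewrite (G_dec ix2 ix1 ix1)// (G_dec ix1 ix2 ix2)//.
  by rewrite mulr0 add0r addr0 !subr0.
have G211_eq0 : G ix2 ix1 ix1 = 0 by lra.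
have G122_eq0 : G ix1 ix2 ix2 = 0 by lra.
by do 3![apply: ord2_ind] => // _; rewrite ?GE.
Qed.

Lemma trace_part_fully_decoupled G : fully_decoupled G ->
  trace_part G = (G ix2 ix2 ix2 +i* G ix1 ix1 ix1)%C.
Proof.
move=> G_dec; rewrite /trace_part (G_dec ix2 ix1 ix1)// (G_dec ix1 ix2 ix2)//.
by rewrite addr0 add0r.
Qed.

Lemma fully_decoupled_rotationP t G : trilinear G ->
  fully_decoupled (tensor_act (rotation t) G) <->
  expi (4 * t) * harmonic_part G = trace_part G.
Proof.
move=> G_tri; rewrite (fully_decoupledP (trilinear_tensor_act _ G_tri)).
rewrite trace_part_rotation// harmonic_part_rotation// expiN expiM_natl.
rewrite (exprS _ 3) -mulrA.
by split=> [<-|<-]; rewrite ?mulVKf ?mulKf ?expi_neq0.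
Qed.

Lemma exists_fully_decoupled_rotationP G : trilinear G ->
  (exists t, fully_decoupled (tensor_act (rotation t) G)) <->
  `|trace_part G| = `|harmonic_part G|.
Proof.
move=> G_tri; rewrite -exists_expi_mulP; split=> [[t]|[t e]].
  by move=> /fully_decoupled_rotationP - /(_ G_tri) e; exists (4 * t).
exists (t / 4); apply/fully_decoupled_rotationP => //.
by rewrite mulrCA divff// mulr1.
Qed.

Lemma fully_decoupleable2P G : trilinear G ->
  fully_decoupleable G <-> `|trace_part G| = `|harmonic_part G|.
Proof.
move=> G_tri; split=> [[s [/orthogonal_mx2P[t _ [->|->]]]]|].
- by move=> t_dec; apply/exists_fully_decoupled_rotationP; last exists t.
- rewrite tensor_actM => t_dec.
  rewrite -normr_trace_part_swap -normr_harmonic_part_swap.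
  apply/exists_fully_decoupled_rotationP; last by exists t.
  exact: trilinear_tensor_act.
- move=> /exists_fully_decoupled_rotationP - /(_ G_tri)[t t_dec].
  by exists (rotation t); split=> //; exact: orthogonal_rotation.
Qed.

Lemma sqr_normr_trace_subr_harmonic G :
  `|trace_part G| ^+ 2 - `|harmonic_part G| ^+ 2 =
  (8 * (G ix1 ix2 ix2 * (G ix1 ix1 ix1 - G ix1 ix2 ix2)
        - G ix2 ix1 ix1 * (G ix2 ix1 ix1 - G ix2 ix2 ix2)))%:C%C.
Proof.
by rewrite -!add_Re2_Im2 -rmorphB; congr (_%:C%C); rewrite /=; ring.
Qed.

Lemma eq_normr_trace_harmonicP G :
  `|trace_part G| = `|harmonic_part G| <->
  G ix2 ix1 ix1 * (G ix2 ix1 ix1 - G ix2 ix2 ix2) =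
  G ix1 ix2 ix2 * (G ix1 ix1 ix1 - G ix1 ix2 ix2).
Proof.
have sub_sqr := sqr_normr_trace_subr_harmonic G; split=> [eq_norm|rel].
  move: sub_sqr; rewrite eq_norm subrr => /complexI/esym/eqP.
  by rewrite mulf_eq0 pnatr_eq0 subr_eq0 => /eqP.
apply/eqP; rewrite -(eqrXn2 (n := 2))// -subr_eq0.
by rewrite sub_sqr rel subrr mulr0.
Qed.

Lemma trilinear_eq0 G : trilinear G ->
  trace_part G = 0 -> harmonic_part G = 0 -> G = 0.
Proof.
move=> /trilinear2E GE [re_u im_u] [re_w im_w].
have G222_eq0 : G ix2 ix2 ix2 = 0 by lra.
have G122_eq0 : G ix1 ix2 ix2 = 0 by lra.
have G211_eq0 : G ix2 ix1 ix1 = 0 by lra.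
have G111_eq0 : G ix1 ix1 ix1 = 0 by lra.
apply/ffunP => i; apply/matrixP => j k; rewrite ffunE mxE.
by move: i j k; do 3![apply: ord2_ind]; rewrite ?GE.
Qed.

Lemma harmonic_part_neq0 G : trilinear G -> G <> 0 ->
  `|trace_part G| = `|harmonic_part G| -> harmonic_part G != 0.
Proof.
move=> G_tri G_neq0 e; apply/eqP => w0; apply/G_neq0/trilinear_eq0 => //.
by apply/eqP; rewrite -normr_eq0 e w0 normr0.
Qed.

Definition decoupling_angles G : set R := [set t : R | 0 <= t < 2 * pi /\
  expi (4 * t) = trace_part G / harmonic_part G].

Lemma decoupling_anglesP G t : trilinear G -> harmonic_part G != 0 ->
  decoupling_angles G t <->
  0 <= t < pi *+ 2 /\ fully_decoupled (tensor_act (rotation t) G).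
Proof.
move=> G_tri w0; rewrite fully_decoupled_rotationP// /decoupling_angles /=.
rewrite [2 * pi]mulr_natl.
by split=> -[t2pi e]; split=> //; [rewrite e divfK|rewrite -e mulfK].
Qed.

Lemma decoupling_angles_decouple G t : trilinear G -> harmonic_part G != 0 ->
  decoupling_angles G t ->
  let RG := tensor_act (rotation t) G in
  fully_decoupled RG /\
  (RG ix2 ix2 ix2 +i* RG ix1 ix1 ix1)%C = expi (- t) * trace_part G.
Proof.
move=> G_tri w0 /decoupling_anglesP[]// _ RG_dec; split=> //.
by rewrite -trace_part_fully_decoupled// trace_part_rotation.
Qed.

Lemma card_decoupling_angles G : harmonic_part G != 0 ->
  `|trace_part G| = `|harmonic_part G| -> (decoupling_angles G #= `I_4)%card.
Proof.
move=> w0 e; rewrite /decoupling_angles [2 * pi]mulr_natl.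
by apply: card_expiM_natl; rewrite // normf_div e divff ?normr_eq0.
Qed.

Lemma orthogonal_decoupling_angles s G : trilinear G -> harmonic_part G != 0 ->
  orthogonal_mx s -> fully_decoupled (tensor_act s G) ->
  (exists2 t, decoupling_angles G t & s = rotation t) \/
  (exists2 t, decoupling_angles (tensor_act swap_mx G) t &
     s = rotation t *m swap_mx).
Proof.
move=> G_tri w0 /orthogonal_mx2P[t t2pi [->|->]]; last rewrite tensor_actM.
  by left; exists t => //; apply/decoupling_anglesP.
right; exists t => //; apply/decoupling_anglesP => //.
  exact: trilinear_tensor_act.
by rewrite harmonic_part_swap_eq0.
Qed.

End PlaneTensors.

Theorem proposition2p5 (R : realType) (G : tensor R 2)
    (G_neq0 : G <> 0) (G_tri : trilinear G) :
  let a3 := G ix1 ix1 ix1 in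
  let a2 := G ix2 ix1 ix1 in
  let a1 := G ix1 ix2 ix2 in
  let a0 := G ix2 ix2 ix2 in
  let relation := a2 * (a2 - a0) = a1 * (a3 - a1) in
  let Theta : set R := [set t : R | 0 <= t < 2 * pi /\
    expi (4 * t) = ((a0 + a2) +i* (a1 + a3))%C
                   / ((a0 - 3 * a2) +i* (a3 - 3 * a1))%C] in
  let Psi : set R := [set p : R | 0 <= p < 2 * pi /\
    expi (4 * p) = ((a3 + a1) +i* (a2 + a0))%C
                   / ((a3 - 3 * a1) +i* (a0 - 3 * a2))%C] in
  (fully_decoupleable G <-> relation) /\
  (relation ->
    [/\ forall t, Theta t ->
          let RG := tensor_act (rotation t) G in
          fully_decoupled RG /\
          (RG ix2 ix2 ix2 +i* RG ix1 ix1 ix1)%C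
            = expi (- t) * ((a0 + a2) +i* (a1 + a3))%C,
        forall p, Psi p ->
          let SG := tensor_act (rotation p *m swap_mx) G in
          fully_decoupled SG /\
          (SG ix2 ix2 ix2 +i* SG ix1 ix1 ix1)%C
            = expi (- p) * ((a3 + a1) +i* (a0 + a2))%C,
        (Theta #= `I_4)%card,
        (Psi #= `I_4)%card &
        forall s : 'M[R]_2, orthogonal_mx s ->
          fully_decoupled (tensor_act s G) ->
          (exists2 t, Theta t & s = rotation t) \/
          (exists2 p, Psi p & s = rotation p *m swap_mx)]).
Proof.
move=> a3 a2 a1 a0 relation Theta Psi.
pose H := tensor_act swap_mx G.
have H_tri : trilinear H by exact: trilinear_tensor_act.
have PsiE : Psi = decoupling_angles H.
  by rewrite /decoupling_angles trace_part_swap harmonic_part_swap.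
split; first by rewrite fully_decoupleable2P// eq_normr_trace_harmonicP.
move=> /eq_normr_trace_harmonicP normG.
have wG := harmonic_part_neq0 G_tri G_neq0 normG.
have normH : `|trace_part H| = `|harmonic_part H|.
  by rewrite normr_trace_part_swap normr_harmonic_part_swap.
have wH : harmonic_part H != 0 by rewrite harmonic_part_swap_eq0.
rewrite PsiE; split.
- by move=> t; exact: decoupling_angles_decouple.
- move=> p p_angle; rewrite tensor_actM [a0 + a2]addrC -trace_part_swap.
  exact: decoupling_angles_decouple.
- exact: card_decoupling_angles.
- exact: card_decoupling_angles.
- by move=> s; exact: orthogonal_decoupling_angles.
Qed.
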